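(* Let $M$ and $M'$ be $E$-$E$-bimodules, let $\varphi^{(1)}: M\to M'$ and $\varphi^{(2)}: M\to \mathcal{F}_E(M')^{\geq 2}$ be morphisms of $E$-$E$-bimodules, and let $\varphi:\mathcal{F}_E(M)\to\mathcal{F}_E(M')$ be the algebra morphism determined by the pair $(\varphi^{(1)},\varphi^{(2)})$, with $\varphi|_E=\mathrm{id}_E$. Then $\varphi$ is an algebra isomorphism if and only if $\varphi^{(1)}$ is an isomorphism of $E$-$E$-bimodules.
   Context: $F$ is a field, $E_1,\dots,E_n$ are finite-dimensional semisimple $F$-algebras and $E=\prod_{i=1}^n E_i$. All $E$-$E$-bimodules are finite-dimensional over $F$ and $F$ acts centrally on them (this applies to the bimodules $M$, $M'$, not to $\mathcal F_E(M)$). For an $E$-$E$-bimodule $M$, $\mathcal{F}_E(M)=\prod_{i\ge 0}M^{\otimes i}$ (tensor powers over $E$, $M^{\otimes 0}=E$); for $f\in\mathcal{F}_E(M)$, $f(i)\in M^{\otimes i}$ denotes its degree $i$ component. It is an $F$-algebra with componentwise sum and $(fg)(i)=\sum_{s+t=i}f(s)g(t)$, topologized by the metric $d(f,g)=2^{-\nu(f-g)}$ for $f\ne g$, where $\nu(h)=\min\{i: h(i)\neq 0\}$. $\mathcal{F}_E(M)^{\geq i}$ is the closed ideal of elements $f$ with $f(j)=0$ for $j<i$. $M$ and $E$ are identified with the degree 1 and degree 0 parts. Given a morphism of bimodules $\phi:M\to\mathcal F_E(M')^{\ge1}$ there is a unique continuous algebra morphism $\varphi:\mathcal F_E(M)\to\mathcal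 F_E(M')$ with $\varphi|_E=\mathrm{id}_E$ and $\varphi|_M=\phi$. The morphism determined by the pair $(\varphi^{(1)},\varphi^{(2)})$ is the one with $\varphi(m)=\varphi^{(1)}(m)+\varphi^{(2)}(m)$ for all $m\in M$. *)

(* Defs.v *)
From HB Require Import structures.
From mathcomp Require Import all_boot all_order all_algebra all_field.
From mathcomp Require Import freeg.
From mathcomp Require Import boolp classical_sets topology.

Set Implicit Arguments.
Unset Strict Implicit.
Unset Printing Implicit Defensive.

Import Order.TTheory GRing.Theory Num.Theory.
Local Open Scope ring_scope.

Definition left_ideal (F : fieldType) (A : falgType F) (I : {vspace A}) : Prop :=
  ({:A} * I <= I)%VS.

(* The regular left module is semisimple: every submodule is a direct
   summand. *)
Definition semisimple (F : fieldType) (A : falgType F) : Prop :=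
  forall I : {vspace A}, left_ideal I ->
    exists J : {vspace A},
      [/\ left_ideal J, (I + J)%VS = fullv & (I :&: J)%VS = 0%VS].

(* Algebras are nonzero in the library, so that the product is taken over a
   nonempty index set. *)
Definition prod_alg (F : fieldType) (n : nat) (A : 'I_n.+1 -> falgType F) : Type :=
  {dffun forall i : 'I_n.+1, A i}.

Section ProdAlg.
Context (F : fieldType) (n : nat) (A : 'I_n.+1 -> falgType F).
Local Notation P := (prod_alg A).
Implicit Types x y z : P.

HB.instance Definition _ := Choice.on P.

Definition pr_mk (f : forall i, A i) : P := @finfun _ (fun i => A i) f.

Lemma pr_mkE f i : pr_mk f i = f i. Proof. exact: ffunE. Qed.

Lemma pr_ext x y : (forall i, x i = y i) -> x = y.
Proof. by move=> h; apply/ffunP. Qed.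

Definition pr_zero : P := pr_mk (fun _ => 0).
Definition pr_opp x : P := pr_mk (fun i => - x i).
Definition pr_add x y : P := pr_mk (fun i => x i + y i).
Definition pr_one : P := pr_mk (fun _ => 1).
Definition pr_mul x y : P := pr_mk (fun i => x i * y i).
Definition pr_scale (c : F) x : P := pr_mk (fun i => c *: x i).

Fact pr_addA : associative pr_add.
Proof. by move=> x y z; apply: pr_ext => i; rewrite !pr_mkE addrA. Qed.
Fact pr_addC : commutative pr_add.
Proof. by move=> x y; apply: pr_ext => i; rewrite !pr_mkE addrC. Qed.
Fact pr_add0 : left_id pr_zero pr_add.
Proof. by move=> x; apply: pr_ext => i; rewrite !pr_mkE add0r. Qed.
Fact pr_addN : left_inverse pr_zero pr_opp pr_add.
Proof. by move=> x; apply: pr_ext => i; rewrite !pr_mkE addNr. Qed.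

HB.instance Definition _ :=
  GRing.isZmodule.Build P pr_addA pr_addC pr_add0 pr_addN.

Fact pr_mulA : associative pr_mul.
Proof. by move=> x y z; apply: pr_ext => i; rewrite !pr_mkE mulrA. Qed.
Fact pr_mul1l : left_id pr_one pr_mul.
Proof. by move=> x; apply: pr_ext => i; rewrite !pr_mkE mul1r. Qed.
Fact pr_mul1r : right_id pr_one pr_mul.
Proof. by move=> x; apply: pr_ext => i; rewrite !pr_mkE mulr1. Qed.
Fact pr_mulDl : left_distributive pr_mul pr_add.
Proof. by move=> x y z; apply: pr_ext => i; rewrite !pr_mkE mulrDl. Qed.
Fact pr_mulDr : right_distributive pr_mul pr_add.
Proof. by move=> x y z; apply: pr_ext => i; rewrite !pr_mkE mulrDr. Qed.
Fact pr_one_neq0 : pr_one != 0 :> P.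
Proof.
apply/eqP => /(congr1 (fun x : P => x ord0)); rewrite !pr_mkE => /eqP.
by rewrite oner_eq0.
Qed.

HB.instance Definition _ := GRing.Zmodule_isNzRing.Build P
  pr_mulA pr_mul1l pr_mul1r pr_mulDl pr_mulDr pr_one_neq0.

Fact pr_scaleA c d x : pr_scale c (pr_scale d x) = pr_scale (c * d) x.
Proof. by apply: pr_ext => i; rewrite !pr_mkE scalerA. Qed.
Fact pr_scale1 : left_id 1 pr_scale.
Proof. by move=> x; apply: pr_ext => i; rewrite !pr_mkE scale1r. Qed.
Fact pr_scaleDr : right_distributive pr_scale +%R.
Proof. by move=> c x y; apply: pr_ext => i; rewrite !pr_mkE scalerDr. Qed.
Fact pr_scaleDl x : {morph pr_scale^~ x : c d / c + d}.
Proof. by move=> c d; apply: pr_ext => i; rewrite !pr_mkE scalerDl. Qed.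

HB.instance Definition _ := GRing.Zmodule_isLmodule.Build F P
  pr_scaleA pr_scale1 pr_scaleDr pr_scaleDl.

Fact pr_scaleAl (c : F) (x y : P) : c *: (x * y) = (c *: x) * y.
Proof. by apply: pr_ext => i; rewrite !pr_mkE scalerAl. Qed.

HB.instance Definition _ := GRing.Lmodule_isLalgebra.Build F P pr_scaleAl.

Fact pr_scaleAr (c : F) (x y : P) : c *: (x * y) = x * (c *: y).
Proof. by apply: pr_ext => i; rewrite !pr_mkE scalerAr. Qed.

HB.instance Definition _ := GRing.Lalgebra_isAlgebra.Build F P pr_scaleAr.

End ProdAlg.

(* lact a v is av and ract v a is va; the last two axioms say that F acts
   centrally. *)
HB.mixin Record Lmodule_isBimodule (F : fieldType) (E : algType F) V
    of GRing.Lmodule F V := {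
  lact : E -> V -> V;
  ract : V -> E -> V;
  lactDl : forall a b v, lact (a + b) v = lact a v + lact b v;
  lactDr : forall a v w, lact a (v + w) = lact a v + lact a w;
  lact1 : forall v, lact 1 v = v;
  lactM : forall a b v, lact (a * b) v = lact a (lact b v);
  ractDl : forall v w a, ract (v + w) a = ract v a + ract w a;
  ractDr : forall v a b, ract v (a + b) = ract v a + ract v b;
  ract1 : forall v, ract v 1 = v;
  ractM : forall v a b, ract v (a * b) = ract (ract v a) b;
  lractA : forall a v b, ract (lact a v) b = lact a (ract v b);
  lact_scalar : forall (c : F) v, lact c%:A v = c *: v;
  ract_scalar : forall (c : F) v, ract v c%:A = c *: v
}.

#[short(type="bimodType")]
HB.structure Definition Bimodule (F : fieldType) (E : algType F) :=
  {V of Lmodule_isBimodule F E V & GRing.Lmodule F V}.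

#[short(type="finBimodType")]
HB.structure Definition FinBimodule (F : fieldType) (E : algType F) :=
  {V of Bimodule F E V & Vector F V}.

Arguments lact {F E s}.
Arguments ract {F E s}.

Definition bimod_morphism (F : fieldType) (E : algType F) (V W : bimodType E)
    (f : V -> W) : Prop :=
  [/\ {morph f : v w / v + w},
      forall a v, f (lact a v) = lact a (f v) &
      forall v a, f (ract v a) = ract (f v) a].

Lemma lactZ (F : fieldType) (E : algType F) (V : bimodType E) a c (v : V) :
  lact a (c *: v) = c *: lact a v.
Proof. by rewrite -!lact_scalar -!lactM mulr_algl mulr_algr. Qed.

Lemma ractZ (F : fieldType) (E : algType F) (V : bimodType E) a c (v : V) :
  ract (c *: v) a = c *: ract v a.
Proof. by rewrite -!ract_scalar -!ractM mulr_algl mulr_algr. Qed.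

Lemma lact0 (F : fieldType) (E : algType F) (V : bimodType E) a :
  lact a (0 : V) = 0.
Proof. by rewrite -(scale0r (0 : V)) lactZ !scale0r. Qed.

Lemma ract0 (F : fieldType) (E : algType F) (V : bimodType E) a :
  ract (0 : V) a = 0.
Proof. by rewrite -(scale0r (0 : V)) ractZ !scale0r. Qed.

Section Tensor.
Context (F : fieldType) (E : algType F) (M N : bimodType E).
Implicit Types (m : M) (n : N) (a b : E) (c : F).

Definition free_tensor : Type := {freeg (M * N)%type / F}.
HB.instance Definition _ := GRing.Lmodule.on free_tensor.

Definition free_pair m n : free_tensor := [freeg [:: (1, (m, n))]].

(* The tensor product over E is a quotient of the free F-vector space on M x N
   instead of the free abelian group: as F acts through E, the relation
   TensorRelZl makes this the same quotient. *)
Inductive tensor_rel : free_tensor -> Prop :=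
  | TensorRel0 : tensor_rel 0
  | TensorRelB x y : tensor_rel x -> tensor_rel y -> tensor_rel (x - y)
  | TensorRelZ c x : tensor_rel x -> tensor_rel (c *: x)
  | TensorRelDl m m' n :
      tensor_rel (free_pair (m + m') n - (free_pair m n + free_pair m' n))
  | TensorRelDr m n n' :
      tensor_rel (free_pair m (n + n') - (free_pair m n + free_pair m n'))
  | TensorRelZl c m n : tensor_rel (free_pair (c *: m) n - c *: free_pair m n)
  | TensorRelBal m a n :
      tensor_rel (free_pair (ract m a) n - free_pair m (lact a n)).

Definition tensor_relb (x : free_tensor) : bool := `[< tensor_rel x >].

Fact tensor_relb_zmod_closed : zmod_closed tensor_relb.
Proof.
split=> [|x y /asboolP hx /asboolP hy]; apply/asboolP.
- exact: TensorRel0.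
- exact: TensorRelB.
Qed.

HB.instance Definition _ :=
  GRing.isZmodClosed.Build free_tensor tensor_relb tensor_relb_zmod_closed.

Definition tensor_kernel : zmodClosed free_tensor :=
  GRing.ZmodClosed.clone free_tensor tensor_relb _.

Local Notation Q := (Quotient.quot tensor_kernel).
Definition tensor : Type := Q.
HB.instance Definition _ := GRing.Zmodule.on tensor.

Definition tpi (x : free_tensor) : tensor := \pi_Q%qT x.

Fact tpiD : {morph tpi : x y / x + y}.
Proof. by move=> x y; rewrite /tpi [in LHS]raddfD. Qed.
Fact tpiB : {morph tpi : x y / x - y}.
Proof. by move=> x y; rewrite /tpi [in LHS]raddfB. Qed.

Fact tpi_eq x y : tensor_rel (x - y) -> tpi x = tpi y.
Proof.
move=> h; apply/eqP; rewrite /tpi -(Quotient.idealrBE tensor_kernel).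
exact/asboolP.
Qed.

Fact tpi_eqP x y : tpi x = tpi y -> tensor_rel (x - y).
Proof.
move=> /eqP h; apply/asboolP; move: h; rewrite /tpi.
by rewrite -(Quotient.idealrBE tensor_kernel).
Qed.

Definition trepr (t : tensor) : free_tensor := @repr _ Q t.
Fact treprK : cancel trepr tpi.
Proof. by move=> t; rewrite /tpi /trepr reprK. Qed.

Definition tens m n : tensor := tpi (free_pair m n).

Definition tscale c (t : tensor) : tensor := tpi (c *: trepr t).

Fact tscale_pi c x : tscale c (tpi x) = tpi (c *: x).
Proof.
apply: tpi_eq; rewrite -scalerBr; apply: TensorRelZ.
by apply: tpi_eqP; rewrite treprK.
Qed.

Fact tensor_ind (t : tensor) : exists x, t = tpi x.
Proof. by exists (trepr t); rewrite treprK. Qed.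

Fact tscaleA c d t : tscale c (tscale d t) = tscale (c * d) t.
Proof. by have [x ->] := tensor_ind t; rewrite !tscale_pi scalerA. Qed.
Fact tscale1 : left_id 1 tscale.
Proof. by move=> t; have [x ->] := tensor_ind t; rewrite tscale_pi scale1r. Qed.
Fact tscaleDr : right_distributive tscale +%R.
Proof.
move=> c t u; have [x ->] := tensor_ind t; have [y ->] := tensor_ind u.
by rewrite -tpiD !tscale_pi -tpiD scalerDr.
Qed.
Fact tscaleDl t : {morph tscale^~ t : c d / c + d}.
Proof.
by move=> c d; have [x ->] := tensor_ind t; rewrite !tscale_pi -tpiD scalerDl.
Qed.

HB.instance Definition _ := GRing.Zmodule_isLmodule.Build F tensor
  tscaleA tscale1 tscaleDr tscaleDl.

Fact tpiZ c x : tpi (c *: x) = c *: tpi x. Proof. exact/esym/tscale_pi. Qed.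

Definition balanced (V : lmodType F) (g : M -> N -> V) : Prop :=
  [/\ forall m m' n, g (m + m') n = g m n + g m' n,
      forall m n n', g m (n + n') = g m n + g m n',
      forall c m n, g (c *: m) n = c *: g m n &
      forall m a n, g (ract m a) n = g m (lact a n)].

Definition tlift (V : lmodType F) (g : M -> N -> V) (t : tensor) : V :=
  fglift (fun p => g p.1 p.2) (trepr t : {freeg (M * N)%type / F}).

Section Lift.
Context (V : lmodType F) (g : M -> N -> V).

Let fl (x : free_tensor) : V :=
  fglift (fun p => g p.1 p.2) (x : {freeg (M * N)%type / F}).

Fact fl_pair m n : fl (free_pair m n) = g m n.
Proof. by rewrite /fl /free_pair liftU scale1r. Qed.

Fact flB x y : fl (x - y) = fl x - fl y.
Proof. exact: lift_is_additive. Qed.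

Fact fl0 : fl 0 = 0.
Proof. by rewrite -(subrr 0) flB subrr. Qed.

Fact flD x y : fl (x + y) = fl x + fl y.
Proof. by rewrite -[y in LHS]opprK -[- y]sub0r !flB fl0 sub0r opprK. Qed.

Fact fl_sum (I : Type) (r : seq I) (G : I -> free_tensor) :
  fl (\sum_(i <- r) G i) = \sum_(i <- r) fl (G i).
Proof. exact: (big_morph fl flD fl0). Qed.

Fact flU c p : fl ([freeg [:: (c, p)]]) = c *: g p.1 p.2.
Proof. exact: liftU. Qed.

Fact flZ c x : fl (c *: x) = c *: fl x.
Proof.
have -> : c *: x = \sum_(z <- dom x) ([freeg [:: (c * coeff z x, z)]] : free_tensor).
  by [].
rewrite -[in RHS](freeg_sumE x) !fl_sum scaler_sumr.
by apply: eq_bigr => z _; rewrite !flU scalerA.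
Qed.

Hypothesis gB : balanced g.

Fact fl_rel x : tensor_rel x -> fl x = 0.
Proof.
case: gB => gDl gDr gZl gb.
elim=> {x}; do ?by move=> *; rewrite flB ?flD ?flZ !fl_pair (gDl, gDr, gZl, gb) subrr.
- exact: fl0.
- by move=> x y _ hx _ hy; rewrite flB hx hy subrr.
- by move=> c x _ hx; rewrite flZ hx scaler0.
Qed.

Fact tlift_pi x : tlift g (tpi x) = fl x.
Proof.
apply/eqP; rewrite -subr_eq0 -[X in X - _]/(fl _) -flB; apply/eqP.
by apply/fl_rel/tpi_eqP; rewrite treprK.
Qed.

Lemma tlift_tens m n : tlift g (tens m n) = g m n.
Proof. by rewrite tlift_pi fl_pair. Qed.

Lemma tliftD : {morph tlift g : t u / t + u}.
Proof.
move=> t u; have [x ->] := tensor_ind t; have [y ->] := tensor_ind u.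
by rewrite -tpiD !tlift_pi flD.
Qed.

Lemma tliftZ c t : tlift g (c *: t) = c *: tlift g t.
Proof. by have [x ->] := tensor_ind t; rewrite -tpiZ !tlift_pi flZ. Qed.

End Lift.

Lemma tensDl m m' n : tens (m + m') n = tens m n + tens m' n.
Proof. by rewrite -tpiD; apply/tpi_eq/TensorRelDl. Qed.
Lemma tensDr m n n' : tens m (n + n') = tens m n + tens m n'.
Proof. by rewrite -tpiD; apply/tpi_eq/TensorRelDr. Qed.
Lemma tensZl c m n : tens (c *: m) n = c *: tens m n.
Proof. by rewrite -tpiZ; apply/tpi_eq/TensorRelZl. Qed.
Lemma tens_bal m a n : tens (ract m a) n = tens m (lact a n).
Proof. by apply/tpi_eq/TensorRelBal. Qed.
Lemma tensZr c m n : tens m (c *: n) = c *: tens m n.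
Proof. by rewrite -lact_scalar -tens_bal ract_scalar tensZl. Qed.
Lemma tens_balanced : balanced tens.
Proof. by split; [exact: tensDl|exact: tensDr|exact: tensZl|exact: tens_bal]. Qed.

Lemma tensorP (P : tensor -> Prop) :
  P 0 -> (forall t u, P t -> P u -> P (t + u)) -> (forall m n, P (tens m n)) ->
  forall t, P t.
Proof.
move=> P0 PD Pt t; have [x ->] := tensor_ind t; rewrite -[x]freeg_sumE.
have tpi0 : tpi 0 = 0 by rewrite -(subrr 0) tpiB subrr.
rewrite (big_morph tpi tpiD tpi0); elim/big_ind: _ => // -[m n] _ /=.
suff -> : tpi [freeg [:: (coeff (m, n) x, (m, n))]] = tens (coeff (m, n) x *: m) n.
  exact: Pt.
rewrite tensZl -tpiZ; congr tpi; apply/eqP/freeg_eqP => z.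
by rewrite coeff_fgscale !coeffU mul1r.
Qed.

Definition tlact a : tensor -> tensor := tlift (fun m n => tens (lact a m) n).
Definition tract (t : tensor) a : tensor :=
  tlift (fun m n => tens m (ract n a)) t.

Fact tlact_bal a : balanced (fun m n => tens (lact a m) n).
Proof.
by split=> *; rewrite ?lactDr ?lactZ ?tensDl ?tensDr ?tensZl // -lractA tens_bal.
Qed.
Fact tract_bal a : balanced (fun m n => tens m (ract n a)).
Proof.
split=> *; rewrite ?ractDl ?tensDl ?tensDr ?tensZl //.
by rewrite lractA tens_bal.
Qed.

Lemma tlact_tens a m n : tlact a (tens m n) = tens (lact a m) n.
Proof. exact: tlift_tens (tlact_bal a) m n. Qed.
Lemma tract_tens a m n : tract (tens m n) a = tens m (ract n a).
Proof. exact: tlift_tens (tract_bal a) m n. Qed.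
Fact tlactDr a t u : tlact a (t + u) = tlact a t + tlact a u.
Proof. exact: tliftD (tlact_bal a) t u. Qed.
Fact tractDl t u a : tract (t + u) a = tract t a + tract u a.
Proof. exact: tliftD (tract_bal a) t u. Qed.
Fact tlact0 a : tlact a 0 = 0.
Proof. by apply: (addIr (tlact a 0)); rewrite -tlactDr !add0r. Qed.
Fact tract0 a : tract 0 a = 0.
Proof. by apply: (addIr (tract 0 a)); rewrite -tractDl !add0r. Qed.
Let tl0 := (tlact0, tract0, addr0, scaler0).

Fact tlactDl a b t : tlact (a + b) t = tlact a t + tlact b t.
Proof.
elim/tensorP: t => [|t u ht hu|m n]; rewrite ?tl0 //.
  by rewrite !tlactDr ht hu addrACA.
by rewrite !tlact_tens lactDl tensDl.
Qed.
Fact tlact1 t : tlact 1 t = t.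
Proof.
elim/tensorP: t => [|t u ht hu|m n]; rewrite ?tl0 //.
  by rewrite !tlactDr ht hu.
by rewrite !tlact_tens lact1.
Qed.
Fact tlactM a b t : tlact (a * b) t = tlact a (tlact b t).
Proof.
elim/tensorP: t => [|t u ht hu|m n]; rewrite ?tl0 //.
  by rewrite !tlactDr ht hu.
by rewrite !tlact_tens lactM.
Qed.
Fact tractDr t a b : tract t (a + b) = tract t a + tract t b.
Proof.
elim/tensorP: t => [|t u ht hu|m n]; rewrite ?tl0 //.
  by rewrite !tractDl ht hu addrACA.
by rewrite !tract_tens ractDr tensDr.
Qed.
Fact tract1 t : tract t 1 = t.
Proof.
elim/tensorP: t => [|t u ht hu|m n]; rewrite ?tl0 //.
  by rewrite !tractDl ht hu.
by rewrite !tract_tens ract1.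
Qed.
Fact tractM t a b : tract t (a * b) = tract (tract t a) b.
Proof.
elim/tensorP: t => [|t u ht hu|m n]; rewrite ?tl0 //.
  by rewrite !tractDl ht hu.
by rewrite !tract_tens ractM.
Qed.
Fact tlractA a t b : tract (tlact a t) b = tlact a (tract t b).
Proof.
elim/tensorP: t => [|t u ht hu|m n]; rewrite ?tl0 //.
  by rewrite !(tlactDr, tractDl) ht hu.
by rewrite !(tlact_tens, tract_tens).
Qed.
Fact tlact_scalar c t : tlact c%:A t = c *: t.
Proof.
elim/tensorP: t => [|t u ht hu|m n]; rewrite ?tl0 //.
  by rewrite !(tlactDr, tractDl) ht hu scalerDr.
by rewrite tlact_tens lact_scalar tensZl.
Qed.
Fact tract_scalar c t : tract t c%:A = c *: t.
Proof.
elim/tensorP: t => [|t u ht hu|m n]; rewrite ?tl0 //.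
  by rewrite !(tlactDr, tractDl) ht hu scalerDr.
by rewrite tract_tens ract_scalar tensZr.
Qed.

HB.instance Definition _ := Lmodule_isBimodule.Build F E tensor
  tlactDl tlactDr tlact1 tlactM tractDl tractDr tract1 tractM tlractA
  tlact_scalar tract_scalar.

End Tensor.

Definition regular_bimod (F : fieldType) (E : algType F) : Type := E.

Section RegularBimodule.
Context (F : fieldType) (E : algType F).
Local Notation V := (regular_bimod E).

HB.instance Definition _ := GRing.Lmodule.on V.

Definition reg_lact (a : E) (v : V) : V := (a : E) * (v : E).
Definition reg_ract (v : V) (a : E) : V := (v : E) * (a : E).

Fact reg_lactDl a b v : reg_lact (a + b) v = reg_lact a v + reg_lact b v.
Proof. exact: mulrDl. Qed.
Fact reg_lactDr a v w : reg_lact a (v + w) = reg_lact a v + reg_lact a w.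
Proof. exact: mulrDr. Qed.
Fact reg_lact1 v : reg_lact 1 v = v. Proof. exact: mul1r. Qed.
Fact reg_lactM a b v : reg_lact (a * b) v = reg_lact a (reg_lact b v).
Proof. exact/esym/mulrA. Qed.
Fact reg_ractDl v w a : reg_ract (v + w) a = reg_ract v a + reg_ract w a.
Proof. exact: mulrDl. Qed.
Fact reg_ractDr v a b : reg_ract v (a + b) = reg_ract v a + reg_ract v b.
Proof. exact: mulrDr. Qed.
Fact reg_ract1 v : reg_ract v 1 = v. Proof. exact: mulr1. Qed.
Fact reg_ractM v a b : reg_ract v (a * b) = reg_ract (reg_ract v a) b.
Proof. exact: mulrA. Qed.
Fact reg_lractA a v b : reg_ract (reg_lact a v) b = reg_lact a (reg_ract v b).
Proof. exact/esym/mulrA. Qed.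
Fact reg_lact_scalar (c : F) v : reg_lact c%:A v = c *: v.
Proof. exact: mulr_algl. Qed.
Fact reg_ract_scalar (c : F) v : reg_ract v c%:A = c *: v.
Proof. exact: mulr_algr. Qed.

HB.instance Definition _ := Lmodule_isBimodule.Build F E V
  reg_lactDl reg_lactDr reg_lact1 reg_lactM reg_ractDl reg_ractDr reg_ract1
  reg_ractM reg_lractA reg_lact_scalar reg_ract_scalar.

End RegularBimodule.

(* M^{(x) 0} = E and M^{(x) (i + 1)} = M (x) M^{(x) i}; in particular the
   degree 1 part is M (x) E, to which M is identified by m |-> m (x) 1. *)
Fixpoint tpow (F : fieldType) (E : algType F) (M : bimodType E) (i : nat) :
    bimodType E :=
  if i is j.+1 then (tensor M (tpow M j) : bimodType E)
  else (regular_bimod E : bimodType E).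

Section TensorPower.
Context (F : fieldType) (E : algType F) (M : bimodType E).
Local Notation T := (tpow M).

(* (m_1 (x) ... (x) m_s (x) a) (x) y |-> m_1 (x) ... (x) m_s (x) ay; tlift, total
   in its argument, is applied to a map that is balanced by tmul_spec. *)
Fixpoint tmul (s t : nat) : T s -> T t -> T (s + t)%N :=
  if s is s'.+1 then
    fun (x : T s'.+1) y => tlift (fun m (x' : T s') => tens m (tmul x' y)) x
  else fun (a : E) y => lact a y.

Definition tcast (s t : nat) (e : s = t) (x : T s) : T t := ecast i (T i) e x.

Definition tcons (s : nat) (m : M) (x : T s) : T s.+1 := tens m x.

Fact tconsDr s m (x y : T s) : tcons m (x + y) = tcons m x + tcons m y.
Proof. exact: tensDr. Qed.

Lemma tpowSP s (P : T s.+1 -> Prop) :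
  P 0 -> (forall x y, P x -> P y -> P (x + y)) ->
  (forall m (x : T s), P (tcons m x)) -> forall x, P x.
Proof. exact: tensorP. Qed.

Fact tmul_spec s :
  [/\ forall t (x : T s) (y y' : T t), tmul x (y + y') = tmul x y + tmul x y',
      forall t a (x : T s) (y : T t), tmul (lact a x) y = lact a (tmul x y),
      forall t (x x' : T s) (y : T t), tmul (x + x') y = tmul x y + tmul x' y,
      forall t a (x : T s) (y : T t), tmul (ract x a) y = tmul x (lact a y) &
      forall t (y : T t),
        balanced (fun m (x : T s) => tens m (tmul x y) : T (s.+1 + t)%N)].
Proof.
elim: s => [|s [IDr ILl IDl IRl IB]].
  split.
  - by move=> t x y y'; exact: lactDr.
  - by move=> t a x y; exact: lactM.
  - by move=> t x x' y; exact: lactDl.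
  - by move=> t a x y; exact: lactM.
  - move=> t y; split=> [m m' n|m n n'|c m n|m a n]; rewrite /=.
    + exact: tensDl.
    + by rewrite -tensDr; congr tens; exact: lactDl.
    + exact: tensZl.
    + by rewrite tens_bal; congr tens; exact/esym/lactM.
have E1 t m (x : T s) (y : T t) : tmul (tcons m x) y = tcons m (tmul x y).
  by exact: tlift_tens (IB t y) m x.
have EDl t (x x' : T s.+1) (y : T t) : tmul (x + x') y = tmul x y + tmul x' y.
  exact: tliftD (IB t y) x x'.
have E0 t (y : T t) : tmul (0 : T s.+1) y = 0.
  by apply: (addIr (tmul (0 : T s.+1) y)); rewrite -EDl !add0r.
have ELl t a (x : T s.+1) (y : T t) : tmul (lact a x) y = lact a (tmul x y).
  elim/tpowSP: x => [|x x' hx hx'|m x].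
  - by rewrite lact0 !E0 lact0.
  - by rewrite lactDr !EDl lactDr hx hx'.
  - have -> : lact a (tcons m x) = tcons (lact a m) x by exact: tlact_tens.
    by rewrite !E1; exact/esym/tlact_tens.
have ERl t a (x : T s.+1) (y : T t) : tmul (ract x a) y = tmul x (lact a y).
  elim/tpowSP: x => [|x x' hx hx'|m x].
  - by rewrite ract0 !E0.
  - by rewrite ractDl !EDl hx hx'.
  - have -> : ract (tcons m x) a = tcons m (ract x a) by exact: tract_tens.
    by rewrite !E1 IRl.
split=> //.
- move=> t x y y'; elim/tpowSP: x => [|x x' hx hx'|m x].
  + by rewrite !E0 addr0.
  + by rewrite !EDl hx hx' addrACA.
  + by rewrite !E1 IDr tconsDr.
- move=> t y; split=> [m m' n|m n n'|c m n|m a n].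
  + exact: tensDl.
  + by rewrite -tensDr EDl.
  + exact: tensZl.
  + by rewrite tens_bal ELl.
Qed.

Lemma tmulDr s t (x : T s) (y y' : T t) : tmul x (y + y') = tmul x y + tmul x y'.
Proof. by case: (tmul_spec s). Qed.
Lemma tmulDl s t (x x' : T s) (y : T t) : tmul (x + x') y = tmul x y + tmul x' y.
Proof. by case: (tmul_spec s). Qed.
Lemma tmul_lact s t a (x : T s) (y : T t) :
  tmul (lact a x) y = lact a (tmul x y).
Proof. by case: (tmul_spec s). Qed.
Lemma tmul_bal s t a (x : T s) (y : T t) : tmul (ract x a) y = tmul x (lact a y).
Proof. by case: (tmul_spec s). Qed.
Lemma tmul_tcons s t m (x : T s) (y : T t) :
  tmul (tcons m x) y = tcons m (tmul x y).
Proof. by case: (tmul_spec s) => _ _ _ _ B; exact: tlift_tens (B t y) m x. Qed.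
Lemma tmul0 s t (x : T s) : tmul x (0 : T t) = 0.
Proof. by apply: (addIr (tmul x (0 : T t))); rewrite -tmulDr !add0r. Qed.
Lemma tmul0l s t (y : T t) : tmul (0 : T s) y = 0.
Proof. by apply: (addIr (tmul (0 : T s) y)); rewrite -tmulDl !add0r. Qed.
Lemma tmulZl s t (c : F) (x : T s) (y : T t) : tmul (c *: x) y = c *: tmul x y.
Proof. by rewrite -!lact_scalar tmul_lact. Qed.
Lemma tmulZr s t (c : F) (x : T s) (y : T t) : tmul x (c *: y) = c *: tmul x y.
Proof. by rewrite -lact_scalar -tmul_bal ract_scalar tmulZl. Qed.

Lemma tcast_id s (e : s = s) (x : T s) : tcast e x = x.
Proof. by rewrite /tcast eq_axiomK. Qed.
Lemma tcastD s t (e : s = t) : {morph tcast e : x y / x + y}.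
Proof. by case: t / e. Qed.
Lemma tcast0 s t (e : s = t) : tcast e 0 = 0.
Proof. by case: t / e. Qed.
Lemma tcastZ s t (e : s = t) (c : F) x : tcast e (c *: x) = c *: tcast e x.
Proof. by case: t / e. Qed.
Lemma tcast_lact s t (e : s = t) a x : tcast e (lact a x) = lact a (tcast e x).
Proof. by case: t / e. Qed.
Lemma tcast_tcons s t (e : s = t) (e' : s.+1 = t.+1) m x :
  tcast e' (tcons m x) = tcons m (tcast e x).
Proof. by case: t / e e' => e'; rewrite !tcast_id. Qed.

Lemma tmulA s t u (e : (s + t + u = s + (t + u))%N) (x : T s) (y : T t) (z : T u) :
  tcast e (tmul (tmul x y) z) = tmul x (tmul y z).
Proof.
elim: s e x => [|s IH] e x; first by rewrite tcast_id; exact: (tmul_lact (x : E) y z).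
elim/tpowSP: x => [|x x' hx hx'|m x]; first by rewrite !tmul0l tcast0.
  by rewrite !tmulDl tcastD hx hx'.
rewrite !tmul_tcons -(IH (esym (addnA s t u))); exact: tcast_tcons.
Qed.

Lemma tmul_deg0 s (e : (s + 0 = s)%N) (x : T s) (a : E) :
  tcast e (tmul x (a : T 0)) = ract x a.
Proof.
elim: s e x => [|s IH] e x; first by rewrite tcast_id.
elim/tpowSP: x => [|x x' hx hx'|m x]; first by rewrite tmul0l tcast0 ract0.
  by rewrite tmulDl tcastD hx hx' ractDl.
rewrite tmul_tcons (tcast_tcons (addn0 s)) IH; exact/esym/tract_tens.
Qed.

Lemma tmul_ract s t (x : T s) (y : T t) a : tmul x (ract y a) = ract (tmul x y) a.
Proof.
elim: s x => [|s IH] x; first exact/esym/lractA.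
elim/tpowSP: x => [|x x' hx hx'|m x]; first by rewrite !tmul0l ract0.
  by rewrite !tmulDl ractDl hx hx'.
by rewrite !tmul_tcons IH; exact/esym/tract_tens.
Qed.

(* tmul x y seen in degree k, or 0 if k is not its degree *)
Definition tmul_at k s t (x : T s) (y : T t) : T k :=
  if (s + t)%N =P k is ReflectT e then tcast e (tmul x y) else 0.

Fact tmul_atE k s t (e : (s + t = k)%N) (x : T s) (y : T t) :
  tmul_at k x y = tcast e (tmul x y).
Proof.
by rewrite /tmul_at; case: eqP => // e'; rewrite (eq_irrelevance e' e).
Qed.
Fact tmul_atN k s t (x : T s) (y : T t) : (s + t != k)%N -> tmul_at k x y = 0.
Proof. by rewrite /tmul_at; case: eqP. Qed.
Fact tmul_atDl k s t (x x' : T s) (y : T t) :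
  tmul_at k (x + x') y = tmul_at k x y + tmul_at k x' y.
Proof. by rewrite /tmul_at; case: eqP => e; rewrite ?addr0 // tmulDl tcastD. Qed.
Fact tmul_atDr k s t (x : T s) (y y' : T t) :
  tmul_at k x (y + y') = tmul_at k x y + tmul_at k x y'.
Proof. by rewrite /tmul_at; case: eqP => e; rewrite ?addr0 // tmulDr tcastD. Qed.
Fact tmul_at0 k s t (x : T s) : tmul_at k x (0 : T t) = 0.
Proof. by rewrite /tmul_at; case: eqP => e //; rewrite tmul0 tcast0. Qed.
Fact tmul_at0l k s t (y : T t) : tmul_at k (0 : T s) y = 0.
Proof. by rewrite /tmul_at; case: eqP => e //; rewrite tmul0l tcast0. Qed.
Fact tmul_atA k s t u (x : T s) (y : T t) (z : T u) :
  tmul_at k (tmul x y) z = tmul_at k x (tmul y z).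
Proof.
have [e|ne] := eqVneq (s + (t + u))%N k; last first.
  by rewrite !tmul_atN // -addnA.
rewrite (tmul_atE e) -(tmulA (esym (addnA s t u))).
by case: k / e; rewrite tcast_id -tmul_atE.
Qed.
Fact tmul_at_sumr k s t (x : T s) (I : Type) (r : seq I) (P : pred I)
    (G : I -> T t) :
  tmul_at k x (\sum_(i <- r | P i) G i) = \sum_(i <- r | P i) tmul_at k x (G i).
Proof. exact: (big_morph _ (@tmul_atDr k s t x) (@tmul_at0 k s t x)). Qed.
Fact tmul_at_suml k s t (y : T t) (I : Type) (r : seq I) (P : pred I)
    (G : I -> T s) :
  tmul_at k (\sum_(i <- r | P i) G i) y = \sum_(i <- r | P i) tmul_at k (G i) y.
Proof.
exact: (big_morph (fun x => tmul_at k x y) (fun x x' => @tmul_atDl k s t x x' y)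
  (@tmul_at0l k s t y)).
Qed.

End TensorPower.

Record complete_tensor_alg (F : fieldType) (E : algType F) (M : bimodType E) :=
  CompleteTensor { component :> forall i : nat, tpow M i }.

Section CompleteTensorAlg.
Context (F : fieldType) (E : algType F) (M : bimodType E).
Local Notation T := (tpow M).
Local Notation FM := (complete_tensor_alg M).
Implicit Types f g h : FM.

HB.instance Definition _ := gen_eqMixin FM.
HB.instance Definition _ := gen_choiceMixin FM.

Lemma cta_ext f g : (forall i, f i = g i) -> f = g.
Proof.
by case: f g => f [g] /= h; congr CompleteTensor; exact: functional_extensionality_dep.
Qed.

Definition cta_zero : FM := CompleteTensor (fun _ => 0).
Definition cta_opp f : FM := CompleteTensor (fun i => - f i).
Definition cta_add f g : FM := CompleteTensor (fun i => f i + g i).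
Definition cta_scale (c : F) f : FM := CompleteTensor (fun i => c *: f i).
Definition cta_mul f g : FM :=
  CompleteTensor (fun i =>
    \sum_(s < i.+1) tcast (subnKC (leq_ord s)) (tmul (f s) (g (i - s)%N))).

Definition of_degree0 (a : E) : FM :=
  CompleteTensor (fun i => if i is 0 return T i then a : T 0 else 0).
Definition of_degree1 (m : M) : FM :=
  CompleteTensor
    (fun i => if i is 1 return T i then tens m ((1 : E) : T 0) else 0).

Fact cta_addA : associative cta_add.
Proof. by move=> f g h; apply: cta_ext => i; exact: addrA. Qed.
Fact cta_addC : commutative cta_add.
Proof. by move=> f g; apply: cta_ext => i; exact: addrC. Qed.
Fact cta_add0 : left_id cta_zero cta_add.
Proof. by move=> f; apply: cta_ext => i; exact: add0r. Qed.
Fact cta_addN : left_inverse cta_zero cta_opp cta_add.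
Proof. by move=> f; apply: cta_ext => i; exact: addNr. Qed.

HB.instance Definition _ :=
  GRing.isZmodule.Build FM cta_addA cta_addC cta_add0 cta_addN.

Fact cta_mul_at f g k :
  cta_mul f g k = \sum_(s < k.+1) tmul_at k (f s) (g (k - s)%N).
Proof. by apply: eq_bigr => s _; exact/esym/tmul_atE. Qed.

Fact cta_mulE N k f g : (k <= N)%N ->
  cta_mul f g k = \sum_(s < N.+1) \sum_(t < N.+1) tmul_at k (f s) (g t).
Proof.
move=> leN; rewrite cta_mul_at.
rewrite -(big_mkord xpredT (fun s => tmul_at k (f s) (g (k - s)%N))).
rewrite -(big_mkord xpredT (fun s => \sum_(t < N.+1) tmul_at k (f s) (g t))).
rewrite [RHS](big_cat_nat (n := k.+1)) //=.
rewrite [X in _ = _ + X]big1_seq ?addr0; last first.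
  move=> s /andP[_]; rewrite mem_index_iota => /andP[ks _].
  by apply: big1 => t _; apply: tmul_atN; rewrite gtn_eqF // ltn_addr.
apply: eq_big_nat => s /andP[_ sk].
have lt : (k - s < N.+1)%N by rewrite ltnS (leq_trans (leq_subr _ _)).
rewrite (bigD1 (Ordinal lt)) //= big1 ?addr0 // => t ne.
apply: tmul_atN; apply: contra ne => /eqP e; apply/eqP/val_inj.
by rewrite /= -e addKn.
Qed.

Fact tmul_at_at k s t u (x : T s) (y : T t) (z : T u) :
  \sum_(v < k.+1) tmul_at k x (tmul_at v y z) = tmul_at k x (tmul y z).
Proof.
have [le|lt] := leqP (t + u) k; last first.
  rewrite big1 => [|v _].
    by rewrite tmul_atN // gtn_eqF // ltn_addl.
  by rewrite [tmul_at v y z]tmul_atN ?tmul_at0 // gtn_eqF // (leq_ltn_trans _ lt) // -ltnS.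
have lt : (t + u < k.+1)%N by [].
rewrite (bigD1 (Ordinal lt)) //= big1 ?addr0 => [|v ne].
  by rewrite (tmul_atE (erefl (t + u)%N)) tcast_id.
by rewrite [tmul_at v y z]tmul_atN ?tmul_at0 // eq_sym.
Qed.

Fact tmul_at_atl k s t u (x : T s) (y : T t) (z : T u) :
  \sum_(v < k.+1) tmul_at k (tmul_at v x y) z = tmul_at k (tmul x y) z.
Proof.
have [le|lt] := leqP (s + t) k; last first.
  rewrite big1 => [|v _].
    by rewrite tmul_atN // gtn_eqF // ltn_addr.
  by rewrite [tmul_at v x y]tmul_atN ?tmul_at0l // gtn_eqF // (leq_ltn_trans _ lt) // -ltnS.
have lt : (s + t < k.+1)%N by [].
rewrite (bigD1 (Ordinal lt)) //= big1 ?addr0 => [|v ne].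
  by rewrite (tmul_atE (erefl (s + t)%N)) tcast_id.
by rewrite [tmul_at v x y]tmul_atN ?tmul_at0l // eq_sym.
Qed.

Fact cta_mulA : associative cta_mul.
Proof.
move=> f g h; apply: cta_ext => k; rewrite !(cta_mulE _ _ (leqnn k)).
transitivity (\sum_(s < k.+1) \sum_(a < k.+1) \sum_(b < k.+1)
    tmul_at k (f s) (tmul (g a) (h b))).
  apply: eq_bigr => s _.
  transitivity (\sum_(t < k.+1) \sum_(a < k.+1) \sum_(b < k.+1)
      tmul_at k (f s) (tmul_at t (g a) (h b))).
    apply: eq_bigr => t _; rewrite (@cta_mulE k) -1?ltnS // tmul_at_sumr.
    by apply: eq_bigr => a _; rewrite tmul_at_sumr.
  rewrite exchange_big /=; apply: eq_bigr => a _.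
  by rewrite exchange_big /=; apply: eq_bigr => b _; exact: tmul_at_at.
transitivity (\sum_(t < k.+1) \sum_(b < k.+1) \sum_(s < k.+1) \sum_(a < k.+1)
    tmul_at k (tmul_at t (f s) (g a)) (h b)); last first.
  apply: eq_bigr => t _; apply: eq_bigr => b _.
  rewrite (@cta_mulE k) -1?ltnS // tmul_at_suml.
  by apply: eq_bigr => s _; rewrite tmul_at_suml.
rewrite [RHS]exchange_big /=.
under [RHS]eq_bigr => b _ do rewrite exchange_big /=.
rewrite [RHS]exchange_big /=; apply: eq_bigr => s _.
under [RHS]eq_bigr => b _ do rewrite exchange_big /=.
rewrite [RHS]exchange_big /=; apply: eq_bigr => a _; apply: eq_bigr => b _.
by rewrite tmul_at_atl tmul_atA.
Qed.

Fact cta_mul_deg0l a f k : cta_mul (of_degree0 a) f k = lact a (f k).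
Proof.
rewrite cta_mul_at big_ord_recl big1 ?addr0 => [|s _]; last exact: tmul_at0l.
by rewrite subn0 (tmul_atE (erefl k : (0 + k = k)%N)) tcast_id.
Qed.

Fact cta_mul_deg0r a f k : cta_mul f (of_degree0 a) k = ract (f k) a.
Proof.
rewrite cta_mul_at big_ord_recr big1 /= => [|s _].
  by rewrite add0r subnn (tmul_atE (addn0 k)) tmul_deg0.
have : (0 < k - s)%N by rewrite subn_gt0.
by case: (k - s)%N => // j _; exact: tmul_at0.
Qed.

Fact cta_mul1l : left_id (of_degree0 1) cta_mul.
Proof. by move=> f; apply: cta_ext => k; rewrite cta_mul_deg0l lact1. Qed.
Fact cta_mul1r : right_id (of_degree0 1) cta_mul.
Proof. by move=> f; apply: cta_ext => k; rewrite cta_mul_deg0r ract1. Qed.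
Fact cta_mulDl : left_distributive cta_mul cta_add.
Proof.
move=> f g h; apply: cta_ext => k; rewrite /= -big_split /=.
by apply: eq_bigr => s _; rewrite tmulDl tcastD.
Qed.
Fact cta_mulDr : right_distributive cta_mul cta_add.
Proof.
move=> f g h; apply: cta_ext => k; rewrite /= -big_split /=.
by apply: eq_bigr => s _; rewrite tmulDr tcastD.
Qed.
Fact cta_one_neq0 : of_degree0 1 != 0 :> FM.
Proof.
apply/eqP => /(congr1 (fun f : FM => f 0%N)) /= /eqP.
by rewrite oner_eq0.
Qed.

HB.instance Definition _ := GRing.Zmodule_isNzRing.Build FM
  cta_mulA cta_mul1l cta_mul1r cta_mulDl cta_mulDr cta_one_neq0.

Fact cta_scaleA c d f : cta_scale c (cta_scale d f) = cta_scale (c * d) f.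
Proof. by apply: cta_ext => i; exact: scalerA. Qed.
Fact cta_scale1 : left_id 1 cta_scale.
Proof. by move=> f; apply: cta_ext => i; exact: scale1r. Qed.
Fact cta_scaleDr : right_distributive cta_scale +%R.
Proof. by move=> c f g; apply: cta_ext => i; exact: scalerDr. Qed.
Fact cta_scaleDl f : {morph cta_scale^~ f : c d / c + d}.
Proof. by move=> c d; apply: cta_ext => i; exact: scalerDl. Qed.

HB.instance Definition _ := GRing.Zmodule_isLmodule.Build F FM
  cta_scaleA cta_scale1 cta_scaleDr cta_scaleDl.

Fact cta_scaleAl (c : F) f g : c *: (f * g) = (c *: f) * g.
Proof.
apply: cta_ext => k; rewrite /= scaler_sumr.
by apply: eq_bigr => s _; rewrite tmulZl tcastZ.
Qed.

HB.instance Definition _ := GRing.Lmodule_isLalgebra.Build F FM cta_scaleAl.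

Fact cta_scaleAr (c : F) f g : c *: (f * g) = f * (c *: g).
Proof.
apply: cta_ext => k; rewrite /= scaler_sumr.
by apply: eq_bigr => s _; rewrite tmulZr tcastZ.
Qed.

HB.instance Definition _ := GRing.Lalgebra_isAlgebra.Build F FM cta_scaleAr.

Definition cta_lact (a : E) f : FM := CompleteTensor (fun i => lact a (f i)).
Definition cta_ract f (a : E) : FM := CompleteTensor (fun i => ract (f i) a).

Fact cta_lactDl a b f : cta_lact (a + b) f = cta_lact a f + cta_lact b f.
Proof. by apply: cta_ext => i; exact: lactDl. Qed.
Fact cta_lactDr a f g : cta_lact a (f + g) = cta_lact a f + cta_lact a g.
Proof. by apply: cta_ext => i; exact: lactDr. Qed.
Fact cta_lact1 f : cta_lact 1 f = f.
Proof. by apply: cta_ext => i; exact: lact1. Qed.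
Fact cta_lactM a b f : cta_lact (a * b) f = cta_lact a (cta_lact b f).
Proof. by apply: cta_ext => i; exact: lactM. Qed.
Fact cta_ractDl f g a : cta_ract (f + g) a = cta_ract f a + cta_ract g a.
Proof. by apply: cta_ext => i; exact: ractDl. Qed.
Fact cta_ractDr f a b : cta_ract f (a + b) = cta_ract f a + cta_ract f b.
Proof. by apply: cta_ext => i; exact: ractDr. Qed.
Fact cta_ract1 f : cta_ract f 1 = f.
Proof. by apply: cta_ext => i; exact: ract1. Qed.
Fact cta_ractM f a b : cta_ract f (a * b) = cta_ract (cta_ract f a) b.
Proof. by apply: cta_ext => i; exact: ractM. Qed.
Fact cta_lractA a f b :
  cta_ract (cta_lact a f) b = cta_lact a (cta_ract f b).
Proof. by apply: cta_ext => i; exact: lractA. Qed.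
Fact cta_lact_scalar (c : F) f : cta_lact c%:A f = c *: f.
Proof. by apply: cta_ext => i; exact: lact_scalar. Qed.
Fact cta_ract_scalar (c : F) f : cta_ract f c%:A = c *: f.
Proof. by apply: cta_ext => i; exact: ract_scalar. Qed.

HB.instance Definition _ := Lmodule_isBimodule.Build F E FM
  cta_lactDl cta_lactDr cta_lact1 cta_lactM cta_ractDl cta_ractDr cta_ract1
  cta_ractM cta_lractA cta_lact_scalar cta_ract_scalar.

Lemma of_degree0_mull a f : of_degree0 a * f = lact a f.
Proof. by apply: cta_ext => k; exact: cta_mul_deg0l. Qed.

Lemma of_degree0_mulr a f : f * of_degree0 a = ract f a.
Proof. by apply: cta_ext => k; exact: cta_mul_deg0r. Qed.

Definition cta_geq (i : nat) : set FM :=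
  [set f : FM | forall j, (j < i)%N -> f j = 0]%classic.

Fact cta_neqP f g : f != g -> exists i, (f - g) i != 0.
Proof.
move=> /eqP ne; apply: contrapT => h; apply: ne; apply: cta_ext => i.
apply/eqP; rewrite -subr_eq0; apply/negPn/negP => fi; apply: h.
by exists i.
Qed.

(* 2 ^ - nu (f - g) for f != g, where nu h is the least i with h(i) != 0; the
   metric takes rational values. *)
Definition cta_dist f g : rat :=
  match boolP (f != g) with
  | AltTrue ne => 2%:R ^- ex_minn (cta_neqP ne)
  | AltFalse _ => 0
  end.

Fact cta_distxx f : cta_dist f f = 0.
Proof. by rewrite /cta_dist; case: {-}_ / boolP => // ne; case/eqP: (ne). Qed.

Fact cta_dist_ge f g i : (f - g) i != 0 -> 2%:R ^- i <= cta_dist f g.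
Proof.
move=> ne; rewrite /cta_dist; case: {-}_ / boolP => [ne'|].
  case: ex_minnP => j _ /(_ _ ne) ji.
  by rewrite lef_pV2 ?posrE ?exprn_gt0 // ler_eXn2l.
by rewrite negbK => /eqP e; rewrite e subrr eqxx in ne.
Qed.

Fact cta_dist_attained f g : f != g ->
  exists2 i, (f - g) i != 0 & cta_dist f g = 2%:R ^- i.
Proof.
move=> ne; rewrite /cta_dist; case: {-}_ / boolP => [ne'|/negP//].
by case: ex_minnP => i hi _; exists i.
Qed.

Fact cta_dist_eq0 f g : cta_dist f g = 0 -> f = g.
Proof.
have [//|/cta_dist_attained[i _ ->] /eqP] := eqVneq f g.
by rewrite invr_eq0 expf_eq0 andbF.
Qed.

Fact cta_dist_ge0 f g : 0 <= cta_dist f g.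
Proof.
have [->|/cta_dist_attained[i _ ->]] := eqVneq f g; first by rewrite cta_distxx.
by rewrite invr_ge0 exprn_ge0.
Qed.

Fact cta_dist_sym f g : cta_dist f g = cta_dist g f.
Proof.
have le u v : cta_dist u v <= cta_dist v u.
  have [->//|/cta_dist_attained[i hi ->]] := eqVneq u v.
  by apply: cta_dist_ge; rewrite -opprB oppr_eq0.
by apply/eqP; rewrite eq_le !le.
Qed.

Fact cta_dist_triangle g f h : cta_dist f h <= cta_dist f g + cta_dist g h.
Proof.
have [->|/cta_dist_attained[i hi ->]] := eqVneq f h.
  by rewrite cta_distxx addr_ge0 ?cta_dist_ge0.
have [e|ne] := eqVneq ((f - g) i) 0; last first.
  by apply: (le_trans (cta_dist_ge ne)); rewrite lerDl cta_dist_ge0.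
have ne : (g - h) i != 0.
  have eq : (f - h) i = (f - g) i + (g - h) i by exact/esym/subrKA.
  by move: hi; rewrite eq e add0r.
by apply: (le_trans (cta_dist_ge ne)); rewrite lerDr cta_dist_ge0.
Qed.

HB.instance Definition _ := isMetric.Build rat FM
  cta_distxx cta_dist_eq0 cta_dist_sym cta_dist_triangle.

End CompleteTensorAlg.

(* Main.v *)
Require Import Defs.
From mathcomp Require Import all_boot all_order all_algebra all_field.
From mathcomp Require Import boolp classical_sets topology.

Set Implicit Arguments.
Unset Strict Implicit.
Unset Printing Implicit Defensive.

Import GRing.Theory.
Local Open Scope ring_scope.

(** Let G_i denote the ideal of elements of order at least i, in either
    completed tensor algebra. The morphism phi is filtered, and its associated
    graded map in degree i is the i-th tensor power of phi1; the equivalence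
    then follows by comparing phi with its associated graded map.

    That phi is filtered comes from M: since M is finite-dimensional,
    with basis b_1, ..., b_d, every element of G_(i+1) is a finite sum of
    products b_j g_j with g_j in G_i ([cta_geqS_generated]). As
    phi (b_j) = phi1 (b_j) + phi2 (b_j) has order at least 1, induction on i
    gives phi (G_i) <= G_i ([phi_geq]). The same decomposition computes the
    leading term ([phi_leading]): in degree i + 1, phi (b_j g_j) is
    phi1 (b_j) (x) phi (g_j)(i), the contribution of phi2 (b_j) having order at
    least i + 2.

    If phi1 is bijective, its inverse is a bimodule morphism and so all its
    tensor powers are bijective ([tpow_map_cancel]). Then phi is injective, as
    a nonzero element has a nonzero leading term ([phi_inj]), and surjective,
    as a preimage is found one degree at a time ([phi_surj_geq]).

    If phi is bijective, a preimage of an element m' of degree 1 has order at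
    least 1, and its degree 1 term is a preimage of m' under phi1
    ([phi1_surj]). Since the tensor powers of phi1 are then also surjective,
    approximation from degree i on shows that phi maps G_i onto G_i. If now
    phi1 m = 0, then phi m = phi2 m lies in G_2 and is the image of an element
    of G_2; by injectivity this element is m, which is of degree 1, so m = 0
    ([phi1_inj]). *)

(** * Bimodule morphisms and their tensor powers *)

Lemma inj_surj_bijective (A B : Type) (f : A -> B) :
  injective f -> (forall y, exists x, f x = y) -> bijective f.
Proof.
move=> fI fS; have [g gK] := choice fS.
by exists g => // x; apply: fI.
Qed.

Section BimoduleMorphisms.
Context (F : fieldType) (E : algType F).

Lemma bimod_morphism_scale (V W : bimodType E) (f : V -> W) :
  bimod_morphism f -> forall (c : F) v, f (c *: v) = c *: f v.
Proof. by case=> _ fL _ c v; rewrite -!lact_scalar fL. Qed.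

Lemma bimod_morphism0 (V W : bimodType E) (f : V -> W) :
  bimod_morphism f -> f 0 = 0.
Proof.
by move=> hf; rewrite -(scale0r (0 : V)) (bimod_morphism_scale hf) !scale0r.
Qed.

Lemma bimod_morphismN (V W : bimodType E) (f : V -> W) :
  bimod_morphism f -> forall v, f (- v) = - f v.
Proof. by move=> hf v; rewrite -!scaleN1r (bimod_morphism_scale hf). Qed.

Lemma bimod_morphism_inverse (V W : bimodType E) (f : V -> W) (g : W -> V) :
  bimod_morphism f -> cancel f g -> cancel g f -> bimod_morphism g.
Proof.
case=> fD fL fR fK gK; have fI := can_inj fK.
by split=> [v w|a v|v a]; apply: fI; rewrite ?fD ?fL ?fR !gK.
Qed.

Fixpoint tpow_map (M M' : bimodType E) (f : M -> M') (i : nat) :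
    tpow M i -> tpow M' i :=
  if i is j.+1 then tlift (fun m (x : tpow M j) => tens (f m) (tpow_map f x))
  else fun a => a.

Arguments tpow_map {M M'} f i x.

Section TpowMap.
Context (M M' : bimodType E) (f : M -> M').
Hypothesis f_morph : bimod_morphism f.

Lemma tensor_map_balanced (N N' : bimodType E) (g : N -> N') :
  bimod_morphism g -> balanced (fun m n => tens (f m) (g n)).
Proof.
case: (f_morph) => fD fL fR [gD gL gR].
split=> [m m' n|m n n'|c m n|m a n].
- by rewrite fD tensDl.
- by rewrite gD tensDr.
- by rewrite (bimod_morphism_scale f_morph) tensZl.
- by rewrite fR gL tens_bal.
Qed.

(** Additivity of [tpow_map f i.+1] and its value on pure tensors both need the
    map inducing it to be balanced, which rests on [tpow_map f i] being a
    bimodule morphism: hence the induction. *)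
Lemma tpow_map_morphism i : bimod_morphism (tpow_map f i).
Proof.
elim: i => [|i IH] //; have B := tensor_map_balanced IH.
have [fD fL fR] := f_morph; have [gD gL gR] := IH.
have E1 m (x : tpow M i) : tpow_map f i.+1 (tens m x) = tens (f m) (tpow_map f i x).
  exact: (tlift_tens B).
have ED x y : tpow_map f i.+1 (x + y) = tpow_map f i.+1 x + tpow_map f i.+1 y.
  exact: (tliftD B).
have E0 : tpow_map f i.+1 0 = 0.
  by apply: (addIr (tpow_map f i.+1 0)); rewrite -ED !add0r.
split=> // [a v|v a].
- elim/tpowSP: v => [|x y hx hy|m x]; first by rewrite lact0 E0 lact0.
    by rewrite lactDr !ED hx hy lactDr.
  have -> : lact a (tcons m x) = tens (lact a m) x by exact: tlact_tens.
  by rewrite !E1 fL; exact/esym/tlact_tens.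
- elim/tpowSP: v => [|x y hx hy|m x]; first by rewrite ract0 E0 ract0.
    by rewrite ractDl !ED hx hy ractDl.
  have -> : ract (tcons m x) a = tens m (ract x a) by exact: tract_tens.
  by rewrite !E1 gR; exact/esym/tract_tens.
Qed.

Lemma tpow_map_tens i m (x : tpow M i) :
  tpow_map f i.+1 (tens m x) = tens (f m) (tpow_map f i x).
Proof. exact: (tlift_tens (tensor_map_balanced (tpow_map_morphism i))). Qed.

Lemma tpow_map_surj i : (forall m', exists m, f m = m') ->
  forall y, exists x, tpow_map f i x = y.
Proof.
move=> fS; elim: i => [|i IH] y; first by exists y.
have [gD _ _] := tpow_map_morphism i.+1.
elim/tpowSP: y => [|y y' [x <-] [x' <-]|m' y].
- by exists 0; exact: bimod_morphism0 (tpow_map_morphism i.+1).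
- by exists (x + x').
- have [m <-] := fS m'; have [x <-] := IH y.
  by exists (tens m x); exact: tpow_map_tens.
Qed.

End TpowMap.

Lemma tpow_map_cancel (M M' : bimodType E) (f : M -> M') (g : M' -> M) i :
  bimod_morphism f -> bimod_morphism g -> cancel f g ->
  cancel (tpow_map f i) (tpow_map g i).
Proof.
move=> hf hg fK; elim: i => [|i IH] x //.
have hf1 := tpow_map_morphism hf i.+1; have hg1 := tpow_map_morphism hg i.+1.
elim/tpowSP: x => [|x y hx hy|m x].
- by rewrite (bimod_morphism0 hf1) (bimod_morphism0 hg1).
- by case: hf1 => -> _ _; case: hg1 => -> _ _; rewrite hx hy.
- by rewrite tpow_map_tens // tpow_map_tens // fK IH.
Qed.

(** The right action m (x) a |-> ma is a left inverse. *)
Lemma tens1_inj (M : bimodType E) :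
  injective (fun m : M => tens m ((1 : E) : tpow M 0)).
Proof.
pose h (t : tpow M 1) : M := tlift (fun m (a : tpow M 0) => ract m a) t.
have hB : balanced (fun (m : M) (a : tpow M 0) => ract m (a : E)).
  split=> [m m' a|m a b|c m a|m a b].
  - exact: ractDl.
  - exact: ractDr.
  - exact: ractZ.
  - exact/esym/ractM.
by apply: (can_inj (g := h)) => m; rewrite /h (tlift_tens hB) ract1.
Qed.

Lemma tpow1P (M : bimodType E) (x : tpow M 1) :
  exists m : M, x = tens m ((1 : E) : tpow M 0).
Proof.
elim/tpowSP: x => [|x y [m ->] [m' ->]|m a].
- by exists 0; rewrite -(scale0r (0 : M)) tensZl scale0r.
- by exists (m + m'); rewrite tensDl.
- exists (ract m a); rewrite tens_bal; congr tens.
  exact/esym/mulr1.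
Qed.

End BimoduleMorphisms.

Arguments tpow_map {F E M M'} f i x.

(** * The order filtration *)

Section Filtration.
Context (F : fieldType) (E : algType F) (M : bimodType E).
Local Notation FM := (complete_tensor_alg M).
Implicit Types f g : FM.

Lemma cta_geq0 f : cta_geq 0 f. Proof. by []. Qed.

Lemma cta_geqB i f g : cta_geq i f -> cta_geq i g -> cta_geq i (f - g).
Proof.
move=> hf hg j ji; have -> : (f - g) j = f j - g j by [].
by rewrite hf // hg // subr0.
Qed.

Lemma cta_geqD i f g : cta_geq i f -> cta_geq i g -> cta_geq i (f + g).
Proof.
move=> hf hg j ji; have -> : (f + g) j = f j + g j by [].
by rewrite hf // hg // addr0.
Qed.

Lemma cta_geq_sum i (I : Type) (r : seq I) (G : I -> FM) :
  (forall k, cta_geq i (G k)) -> cta_geq i (\sum_(k <- r) G k).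
Proof.
by move=> hG; elim/big_ind: _ => // f g; exact: cta_geqD.
Qed.

Lemma cta_geq_le i j f : (i <= j)%N -> cta_geq j f -> cta_geq i f.
Proof. by move=> ij hf k ki; apply: hf; exact: leq_trans ij. Qed.

Lemma cta_geqM i j f g : cta_geq i f -> cta_geq j g -> cta_geq (i + j) (f * g).
Proof.
move=> hf hg k kij; have -> : (f * g) k = cta_mul f g k by [].
rewrite cta_mul_at big1 // => s _.
have [si|is_] := ltnP s i; first by rewrite hf // tmul_at0l.
rewrite hg ?tmul_at0 // ltn_subLR -1?ltnS //.
by apply: leq_trans kij _; rewrite leq_add2r.
Qed.

Lemma cta_geq1 m : cta_geq 1 (of_degree1 (m : M)).
Proof. by case. Qed.

Lemma cta_componentD f g k : (f + g) k = f k + g k. Proof. by []. Qed.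
Lemma cta_componentB f g k : (f - g) k = f k - g k. Proof. by []. Qed.

Lemma cta_component_sum (I : Type) (r : seq I) (G : I -> FM) k :
  (\sum_(i <- r) G i) k = \sum_(i <- r) G i k.
Proof. by apply: (big_morph (fun f : FM => f k)). Qed.

Lemma of_degree1_mulS m g k : (of_degree1 m * g) k.+1 = tens m (g k).
Proof.
have -> : (of_degree1 m * g) k.+1 = cta_mul (of_degree1 m) g k.+1 by [].
rewrite cta_mul_at big_ord_recl tmul_at0l add0r big_ord_recl.
rewrite big1 ?addr0 => [|s _]; last exact: tmul_at0l.
have -> : (k.+1 - lift ord0 (ord0 : 'I_k.+1) = k)%N by rewrite subn1.
rewrite (tmul_atE (erefl k.+1 : (1 + k = k.+1)%N)).
rewrite Defs.tcast_id (tmul_tcons m ((1 : E) : tpow M 0)).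
congr (tcons m _); exact: lact1.
Qed.

Lemma of_degree1_mul0 m g : (of_degree1 m * g) 0%N = 0.
Proof. exact: (cta_geqM (cta_geq1 m) (@cta_geq0 g)). Qed.

Lemma of_degree1B m m' : of_degree1 (m - m' : M) = of_degree1 m - of_degree1 m'.
Proof.
apply: cta_ext => -[|[|k]]; rewrite cta_componentB /= ?subr0 //.
by rewrite -scaleN1r tensDl tensZl scaleN1r.
Qed.

Definition homogeneous k (x : tpow M k) : FM :=
  CompleteTensor (fun i =>
    if k =P i is ReflectT e then Defs.tcast e x else 0).

Lemma homogeneous_diag k (x : tpow M k) : homogeneous x k = x.
Proof. by rewrite /=; case: eqP => // e; rewrite Defs.tcast_id. Qed.

Lemma homogeneous_geq k (x : tpow M k) : cta_geq k (homogeneous x).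
Proof. by move=> j jk /=; case: eqP => // e; exfalso; move: jk; rewrite e ltnn. Qed.

(** Completeness of the algebra, for sequences whose n-th increment has order at
    least n: the k-th component is stationary from u k.+1 on. *)
Lemma cta_limit (u : nat -> FM) :
  (forall n, cta_geq n (u n.+1 - u n)) ->
  exists f, forall n, cta_geq n (f - u n).
Proof.
move=> hu; exists (CompleteTensor (fun k => u k.+1 k)) => n k kn.
rewrite cta_componentB /=; elim: n kn => // n IH; rewrite ltnS leq_eqVlt.
case/orP => [/eqP ->|kn]; first by rewrite subrr.
have := hu n _ kn; rewrite cta_componentB => /eqP; rewrite subr_eq0 => /eqP ->.
exact: IH.
Qed.

End Filtration.

Section Generators.
Context (F : fieldType) (E : algType F) (M : finBimodType E).
Local Notation FM := (complete_tensor_alg M).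
Local Notation b := (vbasis {:M}).

(** The last clause makes the coefficients vanish with t, so that decomposing an
    element of the completed tensor algebra degree by degree lowers its order by
    at most 1. *)
Lemma tensor_basis (N : bimodType E) (t : tensor M N) :
  exists y : 'I_(\dim {:M}) -> N,
    t = \sum_(j < \dim {:M}) tens b`_j (y j) /\ (t = 0 -> forall j, y j = 0).
Proof.
have tens0 (m : M) : tens m (0 : N) = 0.
  by rewrite -(scale0r (0 : N)) tensZr scale0r.
suff [y e] : exists y : 'I_(\dim {:M}) -> N, t = \sum_(j < \dim {:M}) tens b`_j (y j).
  have [t0|/eqP nt] := eqVneq t 0; last by exists y.
  by exists (fun=> 0); split=> //; rewrite t0 big1.
elim/tensorP: t => [|t u [y ->] [z ->]|m n].
- by exists (fun=> 0); rewrite big1.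
- exists (fun j => y j + z j); rewrite -big_split /=.
  by apply: eq_bigr => j _; rewrite tensDr.
- exists (fun j => coord b j m *: n).
  have tens_sum (G : 'I_(\dim {:M}) -> M) : tens (\sum_j G j) n = \sum_j tens (G j) n.
    apply: (big_morph (fun m => tens m n)) => [m1 m2|]; first exact: tensDl.
    by rewrite -(scale0r (0 : M)) tensZl scale0r.
  rewrite [in LHS](coord_vbasis (memvf m)) tens_sum.
  by apply: eq_bigr => j _; rewrite tensZl tensZr.
Qed.

(** Finite dimension is what makes the number of summands independent of the
    degree, so that a ring morphism can be applied to the sum term by term. *)
Lemma cta_geqS_generated (i : nat) (f : FM) : cta_geq i.+1 f ->
  exists g : 'I_(\dim {:M}) -> FM,
    f = \sum_(j < \dim {:M}) of_degree1 b`_j * g j /\ forall j, cta_geq i (g j).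
Proof.
move=> hf; pose y k := projT1 (cid (tensor_basis (f k.+1))).
have yP k : f k.+1 = \sum_(j < \dim {:M}) tens b`_j (y k j) /\
      (f k.+1 = 0 -> forall j, y k j = 0).
  exact: projT2 (cid (tensor_basis (f k.+1))).
exists (fun j => CompleteTensor (fun k => y k j)); split=> [|j k ki].
  apply: cta_ext => k; rewrite cta_component_sum; case: k => [|k].
    by rewrite hf // big1 // => j _; exact: of_degree1_mul0.
  have [-> _] := yP k; apply: eq_bigr => j _.
  by rewrite of_degree1_mulS.
by apply: (yP k).2; exact: hf.
Qed.

End Generators.

(** * The morphism and its associated graded map *)

Section FilteredMorphism.
Context (F : fieldType) (E : algType F) (M : finBimodType E) (M' : bimodType E).
Context (phi1 : M -> M') (phi2 : M -> complete_tensor_alg M').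
Context (phi : {rmorphism complete_tensor_alg M -> complete_tensor_alg M'}).
Hypothesis phi1_morph : bimod_morphism phi1.
Hypothesis phi2_geq2 : forall m, cta_geq 2 (phi2 m).
Hypothesis phi_on_E : forall a, phi (of_degree0 M a) = of_degree0 M' a.
Hypothesis phi_on_M : forall m, phi (of_degree1 m) = of_degree1 (phi1 m) + phi2 m.

Lemma phi_degree1_geq1 m : cta_geq 1 (phi (of_degree1 m)).
Proof.
rewrite phi_on_M; apply: cta_geqD; first exact: cta_geq1.
exact: cta_geq_le (phi2_geq2 m).
Qed.

Lemma phi_geq i f : cta_geq i f -> cta_geq i (phi f).
Proof.
elim: i f => [|i IH] f hf; first by [].
have [g [-> hg]] := cta_geqS_generated hf.
rewrite rmorph_sum; apply: cta_geq_sum => j; rewrite rmorphM.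
by apply: (cta_geqM (i := 1)); [exact: phi_degree1_geq1|exact: IH].
Qed.

Lemma phi_leading i f : cta_geq i f -> phi f i = tpow_map phi1 i (f i).
Proof.
elim: i f => [|i IH] f hf.
  have hr : cta_geq 1 (f - of_degree0 M (f 0%N)).
    by case=> // _; exact: subrr.
  rewrite -[f in LHS](subrK (of_degree0 M (f 0%N))) rmorphD cta_componentD.
  by rewrite (phi_geq hr) // add0r phi_on_E.
have [g [-> hg]] := cta_geqS_generated hf.
have hm := tpow_map_morphism phi1_morph i.+1; have [hD _ _] := hm.
rewrite rmorph_sum !cta_component_sum.
rewrite (big_morph _ hD (bimod_morphism0 hm)); apply: eq_bigr => j _.
rewrite rmorphM phi_on_M mulrDl cta_componentD !of_degree1_mulS.
rewrite (cta_geqM (phi2_geq2 _) (phi_geq (hg j))) ?addr0 //.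
by rewrite IH // tpow_map_tens.
Qed.

(** If phi f = 0, the components of f vanish one after the other: once f has
    order at least i, its component f i is sent to 0 by the graded map. *)
Lemma phi_inj : (forall i, injective (tpow_map phi1 i)) -> injective phi.
Proof.
move=> gI; suff ker0 f : phi f = 0 -> f = 0.
  by move=> f g e; apply/subr0_eq/ker0; rewrite rmorphB e subrr.
move=> pf0; have hf i : cta_geq i f.
  elim: i => [//|i IH] j; rewrite ltnS leq_eqVlt => /orP[/eqP ->|]; last exact: IH.
  apply: (gI i); rewrite -phi_leading // pf0.
  exact/esym/(bimod_morphism0 (tpow_map_morphism phi1_morph i)).
by apply: cta_ext => i; exact: (hf i.+1).
Qed.

(** Successive approximation: the leading term of the error h - phi (u n) is
    lifted by the graded map and added to u n, which raises the order of the
    error by 1. Starting from 0 with an error of order at least i, all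
    corrections have order at least i, hence so has the limit. *)
Lemma phi_surj_geq i h : (forall m', exists m, phi1 m = m') ->
  cta_geq i h -> exists2 f, cta_geq i f & phi f = h.
Proof.
move=> phi1S hh.
pose s k (y : tpow M' k) := projT1 (cid (tpow_map_surj phi1_morph phi1S y)).
have sK k y : tpow_map phi1 k (s k y) = y.
  exact: projT2 (cid (tpow_map_surj phi1_morph phi1S y)).
pose c n f := homogeneous (s (i + n)%N ((h - phi f) (i + n)%N)).
pose fix u n := if n is n'.+1 then u n' + c n' (u n') else 0.
have cu n : cta_geq (i + n) (u n.+1 - u n).
  by rewrite /= addrC addKr; exact: homogeneous_geq.
have hu n : cta_geq (i + n) (h - phi (u n)).
  elim: n => [|n IH]; first by rewrite /= rmorph0 subr0 addn0.
  have -> : h - phi (u n.+1) = (h - phi (u n)) - phi (c n (u n)).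
    by rewrite /= rmorphD opprD addrA.
  (* In degree i + n the correction was chosen to cancel the error; in lower
     degrees both vanish. *)
  rewrite addnS => j; rewrite ltnS leq_eqVlt => /orP[/eqP ->|jn]; last first.
    by apply: (cta_geqB IH _ jn); apply: phi_geq; exact: homogeneous_geq.
  rewrite cta_componentB phi_leading; last exact: homogeneous_geq.
  by rewrite homogeneous_diag sK subrr.
have [f hf] : exists f, forall n, cta_geq n (f - u n).
  by apply: cta_limit => n; apply: cta_geq_le (cu n); exact: leq_addl.
exists f.
  (* f agrees with u i below degree i, and u n has order at least i for all n. *)
  rewrite -(subrK (u i) f); apply: cta_geqD (hf i) _.
  elim: {2}i => [|n IH]; first by [].
  rewrite -(subrK (u n) (u n.+1)); apply: cta_geqD IH.
  by apply: cta_geq_le (cu n); exact: leq_addr.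
(* In degree k, phi f agrees with phi (u k.+1), hence with h. *)
apply: cta_ext => k; have /(_ k (ltnSn k)) := phi_geq (hf k.+1).
rewrite rmorphB cta_componentB => /subr0_eq ->.
have := hu k.+1 k; rewrite cta_componentB addnS ltnS leq_addl => /(_ isT).
by move/subr0_eq.
Qed.

(** In degree 0 the graded map is the identity of E, so that a preimage of an
    element of degree 1 has order at least 1. *)
Lemma phi1_surj : (forall h, exists f, phi f = h) ->
  forall m', exists m, phi1 m = m'.
Proof.
move=> phiS m'; have [f ef] := phiS (of_degree1 m').
have hf : cta_geq 1 f.
  case=> // _; have := @phi_leading 0 f (@cta_geq0 _ _ _ f).
  by rewrite ef /= => <-.
have := phi_leading hf; have [m ->] := tpow1P (f 1%N).
rewrite ef tpow_map_tens // => e; exists m.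
exact/esym/tens1_inj.
Qed.

(** For m in the kernel of phi1, phi m = phi2 m is also the image of some g of
    order at least 2, and comparing m = g in degree 1 gives m = 0. *)
Lemma phi1_inj : bijective phi -> injective phi1.
Proof.
case=> psi phiK psiK m m' e; apply/subr0_eq.
have [phi1D _ _] := phi1_morph.
have e0 : phi1 (m - m') = 0.
  by rewrite phi1D (bimod_morphismN phi1_morph) e subrr.
have hS h : exists f, phi f = h by exists (psi h).
have [g hg eg] := phi_surj_geq (phi1_surj hS) (phi2_geq2 (m - m')).
have : of_degree1 (m - m') = g.
  apply: (can_inj phiK); rewrite eg phi_on_M e0.
  by rewrite -(subrr (0 : M')) of_degree1B subrr add0r.
move=> /(congr1 (fun f : complete_tensor_alg M => f 1%N)).
rewrite (hg 1%N isT) /= => /= e1; apply: tens1_inj; rewrite e1.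
by rewrite -(scale0r (0 : M)) tensZl scale0r.
Qed.

Theorem bijective_iff_linear_part : bijective phi <-> bijective phi1.
Proof.
split=> [phiB|phi1B].
  have [psi _ psiK] := phiB.
  by apply: inj_surj_bijective (phi1_inj phiB) (phi1_surj _) => h; exists (psi h).
have [psi1 phi1K psi1K] := phi1B.
have psi1_morph := bimod_morphism_inverse phi1_morph phi1K psi1K.
apply: inj_surj_bijective.
  apply: phi_inj => i; apply: can_inj.
  exact: (tpow_map_cancel phi1_morph psi1_morph phi1K).
move=> h; have [||f _ <-] := @phi_surj_geq 0 h; last by exists f.
  by move=> m'; exists (psi1 m').
by [].
Qed.

End FilteredMorphism.

Theorem proposition2p7 (F : fieldType) (n : nat)
    (E_ : 'I_n.+1 -> falgType F)
    (E_semisimple : forall i, semisimple (E_ i))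
    (M M' : finBimodType (prod_alg E_))
    (phi1 : M -> M')
    (phi1_morph : bimod_morphism phi1)
    (phi2 : M -> complete_tensor_alg M')
    (phi2_morph : bimod_morphism phi2)
    (phi2_geq2 : forall m : M, cta_geq 2 (phi2 m))
    (phi : {lrmorphism complete_tensor_alg M -> complete_tensor_alg M'})
    (phi_continuous : continuous phi)
    (phi_on_E : forall a : prod_alg E_, phi (of_degree0 M a) = of_degree0 M' a)
    (phi_on_M : forall m : M, phi (of_degree1 m) = of_degree1 (phi1 m) + phi2 m) :
  bijective phi <-> bijective phi1.
Proof. exact: bijective_iff_linear_part phi1_morph phi2_geq2 phi_on_E phi_on_M. Qed.
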